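(* Let $j \geq 1$ be an integer, let $\mathbb{F}_1, \dots, \mathbb{F}_j$ be finite fields all of the same characteristic, and let $n_1, \dots, n_j$ be integers with $n_t > 1$ for every $t \in \{1, \dots, j\}$. Then there exist no finite field $\mathbb{F}_q$ and finite group $G$ such that the group algebra $\mathbb{F}_q G$ is semisimple and $\mathbb{F}_q G \cong \bigoplus_{t=1}^{j} M_{n_t}(\mathbb{F}_t)$ as rings. In other words, the ring $\bigoplus_{t=1}^{j} M_{n_t}(\mathbb{F}_t)$ has no inverse image under the map $\psi$ that sends each finite semisimple group algebra to its Wedderburn decomposition. Consequently, the inverse problem of determining, for a given ring in $O_2$, a finite semisimple group algebra in $O_1$ mapped to it by $\psi$ is ill-posed.
   Context: $O_1$ denotes the set of all finite semisimple group algebras $\mathbb{F}_q G$ (with $\mathbb{F}_q$ a finite field with $q = p^k$ elements, $p$ prime, and $G$ a finite group). $O_2$ denotes the set of all rings of the form $\bigoplus_{t=1}^{j} M_{n_t}(\mathbb{F}_t)$, where $j \geq 1$ and $n_t \geq 1$ are integers and the $\mathbb{F}_t$ are finite fields all of the same characteristic; $M_n(\mathbb{F})$ is the ring of $n \times n$ matrices over $\mathbb{F}$. Rings in $O_2$ are considered up to isomorphism (equivalently, up to reordering of the components). The map $\psi : O_1 \to O_2$ sends each semisimple group algebra to its (unique) Wedderburn decomposition, so that $\psi(\mathbb{F}_q G) = \bigoplus_{t=1}^{j} M_{n_t}(\mathbb{F}_t)$ means $\mathbb{F}_q G \cong \bigoplus_{t=1}^{j} M_{n_t}(\mathbb{F}_t)$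 as rings. The inverse problem is: given $R \in O_2$, find $A \in O_1$ with $\psi(A) = R$. The problem is called ill-posed if, for some $R \in O_2$, it has either no solution or more than one solution. *)

(* Defs.v *)
From HB Require Import structures.
From mathcomp Require Import all_boot all_order all_algebra all_fingroup.
From mathcomp Require Import all_field.

Set Implicit Arguments.
Unset Strict Implicit.
Unset Printing Implicit Defensive.

Import GRing.Theory.
Local Open Scope ring_scope.

Definition ring_isomorphic (A B : pzRingType) : Prop :=
  exists f : {rmorphism A -> B}, bijective f.

(* A function [a] stands for the formal sum \sum_g (a g) g, so the product is
   convolution. This is an alias of {ffun gT -> F} because the latter already
   carries the pointwise product. *)
Definition group_algebra (F : fieldType) (gT : finGroupType) : Type :=
  {ffun gT -> F}.

HB.instance Definition _ (F : fieldType) (gT : finGroupType) :=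
  GRing.Lmodule.copy (group_algebra F gT) {ffun gT -> F^o}.

Section GroupAlgebra.

Variables (F : fieldType) (gT : finGroupType).
Implicit Types a b c : group_algebra F gT.

Definition galg_one : group_algebra F gT := [ffun g => (g == 1%g)%:R].

Definition galg_mul a b : group_algebra F gT :=
  [ffun g => \sum_h a h * b (h^-1 * g)%g].

Fact galg_mulA : associative galg_mul.
Proof.
move=> a b c; apply/ffunP=> g; rewrite !ffunE.
under eq_bigr do rewrite ffunE mulr_sumr.
under [RHS]eq_bigr do rewrite ffunE mulr_suml.
rewrite [RHS]exchange_big; apply: eq_bigr => h _ /=.
rewrite [RHS](reindex_inj (mulgI h)); apply: eq_bigr => k _ /=.
by rewrite mulKg invMg mulgA mulrA.
Qed.

Fact galg_mul1l : left_id galg_one galg_mul.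
Proof.
move=> a; apply/ffunP=> g; rewrite ffunE (bigD1 1%g) //= ffunE eqxx mul1r.
rewrite invg1 mul1g big1 ?addr0 // => h /negPf h1.
by rewrite ffunE h1 mul0r.
Qed.

Fact galg_mul1r : right_id galg_one galg_mul.
Proof.
move=> a; apply/ffunP=> g; rewrite ffunE (bigD1 g) //= ffunE mulVg eqxx mulr1.
rewrite big1 ?addr0 // => h /negPf hg.
by rewrite ffunE -eq_mulVg1 hg mulr0.
Qed.

Fact galg_mulDl : left_distributive galg_mul +%R.
Proof.
move=> a b c; apply/ffunP=> g; rewrite !ffunE -big_split.
by apply: eq_bigr => h _; rewrite ffunE mulrDl.
Qed.

Fact galg_mulDr : right_distributive galg_mul +%R.
Proof.
move=> a b c; apply/ffunP=> g; rewrite !ffunE -big_split.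
by apply: eq_bigr => h _; rewrite ffunE mulrDr.
Qed.

Fact galg_oner_neq0 : galg_one != 0.
Proof. by apply/eqP=> /ffunP/(_ 1%g)/eqP; rewrite !ffunE eqxx oner_eq0. Qed.

HB.instance Definition _ :=
  GRing.Zmodule_isNzRing.Build (group_algebra F gT)
    galg_mulA galg_mul1l galg_mul1r galg_mulDl galg_mulDr galg_oner_neq0.

Fact galg_scaleAl (x : F) a b : x *: (a * b) = x *: a * b.
Proof.
apply/ffunP=> g; rewrite !ffunE scaler_sumr.
by apply: eq_bigr => h _; rewrite ffunE scalerAl.
Qed.

HB.instance Definition _ :=
  GRing.Lmodule_isLalgebra.Build F (group_algebra F gT) galg_scaleAl.

Fact galg_scaleAr (x : F) a b : x *: (a * b) = a * (x *: b).
Proof.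
apply/ffunP=> g; rewrite !ffunE scaler_sumr.
by apply: eq_bigr => h _; rewrite ffunE scalerAr.
Qed.

HB.instance Definition _ :=
  GRing.Lalgebra_isAlgebra.Build F (group_algebra F gT) galg_scaleAr.

End GroupAlgebra.

(* Every submodule is a direct summand. Submodules are boolean predicates, which
   loses no subset when M is finite, the only case needed. *)
Definition semisimple_module (R : pzRingType) (M : lmodType R) : Prop :=
  forall U : {pred M}, submod_closed U ->
  exists V : {pred M},
    [/\ submod_closed V,
        forall x, exists u v, [/\ u \in U, v \in V & x = u + v]
      & forall x, x \in U -> x \in V -> x = 0].

Definition semisimple_ring (R : nzRingType) : Prop :=
  semisimple_module (R^o : lmodType R).

Definition ring_dsum (I : finType) (A : I -> pzRingType) : Type :=
  {dffun forall i, A i}.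

HB.instance Definition _ (I : finType) (A : I -> pzRingType) :=
  Choice.on (ring_dsum A).

Section RingDirectSum.

Variables (I : finType) (A : I -> pzRingType).
Implicit Types x y z : ring_dsum A.

Definition dsum_zero : ring_dsum A := [ffun i => 0 : A i].
Definition dsum_opp x : ring_dsum A := [ffun i => - x i].
Definition dsum_add x y : ring_dsum A := [ffun i => x i + y i].
Definition dsum_one : ring_dsum A := [ffun i => 1 : A i].
Definition dsum_mul x y : ring_dsum A := [ffun i => x i * y i].

Fact dsum_addA : associative dsum_add.
Proof. by move=> x y z; apply/ffunP=> i; rewrite !ffunE addrA. Qed.
Fact dsum_addC : commutative dsum_add.
Proof. by move=> x y; apply/ffunP=> i; rewrite !ffunE addrC. Qed.
Fact dsum_add0 : left_id dsum_zero dsum_add.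
Proof. by move=> x; apply/ffunP=> i; rewrite !ffunE add0r. Qed.
Fact dsum_addN : left_inverse dsum_zero dsum_opp dsum_add.
Proof. by move=> x; apply/ffunP=> i; rewrite !ffunE addNr. Qed.

HB.instance Definition _ :=
  GRing.isZmodule.Build (ring_dsum A) dsum_addA dsum_addC dsum_add0 dsum_addN.

Fact dsum_mulA : associative dsum_mul.
Proof. by move=> x y z; apply/ffunP=> i; rewrite !ffunE mulrA. Qed.
Fact dsum_mul1l : left_id dsum_one dsum_mul.
Proof. by move=> x; apply/ffunP=> i; rewrite !ffunE mul1r. Qed.
Fact dsum_mul1r : right_id dsum_one dsum_mul.
Proof. by move=> x; apply/ffunP=> i; rewrite !ffunE mulr1. Qed.
Fact dsum_mulDl : left_distributive dsum_mul +%R.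
Proof. by move=> x y z; apply/ffunP=> i; rewrite !ffunE mulrDl. Qed.
Fact dsum_mulDr : right_distributive dsum_mul +%R.
Proof. by move=> x y z; apply/ffunP=> i; rewrite !ffunE mulrDr. Qed.

HB.instance Definition _ :=
  GRing.Zmodule_isPzRing.Build (ring_dsum A)
    dsum_mulA dsum_mul1l dsum_mul1r dsum_mulDl dsum_mulDr.

End RingDirectSum.

Definition matrix_dsum (j : nat) (F : 'I_j -> finFieldType) (n : 'I_j -> nat) :
  pzRingType := ring_dsum (fun t : 'I_j => 'M[F t]_(n t) : pzRingType).

Definition same_characteristic (I : Type) (F : I -> finFieldType) : Prop :=
  exists p : nat, forall i, p \in [pchar F i].

Record O1 : Type := MkO1 {
  O1_field : finFieldType;
  O1_group : finGroupType;
  O1_semisimple : semisimple_ring (group_algebra O1_field O1_group)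
}.

(* A presentation of a ring of O_2; rings of O_2 are only compared up to
   isomorphism, through [psi_eq]. *)
Record O2 : Type := MkO2 {
  O2_num : nat;
  O2_field : 'I_O2_num -> finFieldType;
  O2_size : 'I_O2_num -> nat;
  O2_num_gt0 : (0 < O2_num)%N;
  O2_size_gt0 : forall t, (0 < O2_size t)%N;
  O2_char : same_characteristic O2_field
}.

Definition O1_ring (A : O1) : pzRingType :=
  group_algebra (O1_field A) (O1_group A).

Definition O2_ring (R : O2) : pzRingType :=
  matrix_dsum (@O2_field R) (@O2_size R).

(* psi(A) = R, the values of psi being taken up to ring isomorphism. *)
Definition psi_eq (A : O1) (R : O2) : Prop :=
  ring_isomorphic (O1_ring A) (O2_ring R).

(* Two group algebras are the same element of O_1 when they have the same
   field and the same group up to isomorphism. Ring isomorphism would be too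
   coarse (it identifies all the solutions for a given R), and equality of
   records too fine (it separates isomorphic copies of a field or a group). *)
Definition same_group_algebra (A B : O1) : Prop :=
  ring_isomorphic (O1_field A) (O1_field B) /\
  [set: O1_group A] \isog [set: O1_group B].

Definition inverse_problem_ill_posed : Prop :=
  exists R : O2,
    (~ exists A : O1, psi_eq A R) \/
    (exists A B : O1, [/\ psi_eq A R, psi_eq B R & ~ same_group_algebra A B]).

(* Main.v *)
Require Import Defs.
From HB Require Import structures.
From mathcomp Require Import all_boot all_order all_algebra all_fingroup.
From mathcomp Require Import all_field.

(** A group algebra over a field [F] has a nonzero commutative quotient: the
    augmentation, which sums the coefficients, is a ring morphism onto [F].
    A direct sum of matrix rings of sizes at least 2 has none. Indeed, in a
    commutative quotient an off-diagonal matrix unit E_ij = E_ii E_ij becomes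
    equal to E_ij E_ii = 0, hence so does E_ii = E_ij E_ji, and the identity is
    a sum of such elements ([commutative_matrix_image0] for one block,
    [no_commutative_image_matrix_dsum] for the direct sum). So the two rings
    cannot be isomorphic. The inverse problem is then ill-posed because a
    single block, the 2 x 2 matrices over the field with two elements, already
    has no inverse image. *)

Set Implicit Arguments.
Unset Strict Implicit.
Unset Printing Implicit Defensive.

Import GRing.Theory.
Local Open Scope ring_scope.

Section Augmentation.

Variables (F : fieldType) (gT : finGroupType).

Definition augmentation (a : group_algebra F gT) : F := \sum_g a g.

Fact augmentation_is_zmod_morphism : zmod_morphism augmentation.
Proof.
by move=> a b; rewrite -sumrB; apply: eq_bigr => g _; rewrite !ffunE.
Qed.

HB.instance Definition _ :=
  GRing.isZmodMorphism.Build (group_algebra F gT) F augmentation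
    augmentation_is_zmod_morphism.

Fact augmentation_is_monoid_morphism : monoid_morphism augmentation.
Proof.
split=> [|a b]; rewrite /augmentation.
  rewrite (bigD1 1%g) //= ffunE eqxx big1 ?addr0 // => g /negPf g1.
  by rewrite ffunE g1.
under eq_bigr do rewrite ffunE.
rewrite exchange_big mulr_suml; apply: eq_bigr => h _ /=.
rewrite (reindex_inj (mulgI h)) mulr_sumr.
by apply: eq_bigr => g _ /=; rewrite mulKg.
Qed.

HB.instance Definition _ :=
  GRing.isMonoidMorphism.Build (group_algebra F gT) F augmentation
    augmentation_is_monoid_morphism.

End Augmentation.

(** Every diagonal matrix unit is a product E_ik E_ki of two off-diagonal ones,
    which die in a commutative ring. The map [f] is additive and multiplicative
    rather than a ring morphism because it will be the restriction of a ring
    morphism to one block of a direct sum, whose embedding moves the unit. *)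
Lemma commutative_matrix_image0 (R : pzRingType) (C : comPzRingType) (n : nat)
    (f : {additive 'M[R]_n -> C}) :
  (1 < n)%N -> {morph f : A B / A *m B >-> A * B} -> f 1%:M = 0.
Proof.
move=> n_gt1 fM.
have f_off (i k : 'I_n) : i != k -> f (delta_mx i k) = 0.
  move=> neq_ik; rewrite -(mul_delta_mx i i k) fM mulrC -fM.
  by rewrite mul_delta_mx_0 ?raddf0 1?eq_sym.
rewrite mx1_sum_delta raddf_sum big1 // => i _.
have [k neq_ik]: exists k : 'I_n, i != k.
  have n_gt0 := ltnW n_gt1.
  have [i0 | i_neq0] := eqVneq i (Ordinal n_gt0).
    by exists (Ordinal n_gt1); rewrite i0.
  by exists (Ordinal n_gt0).
by rewrite -(mul_delta_mx k i i) fM f_off ?mul0r.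
Qed.

Section DirectSumInjection.

Variables (I : finType) (A : I -> pzRingType) (i : I).

Definition dsum_inj (x : A i) : ring_dsum A :=
  [ffun k => dfwith (fun k => 0 : A k) x k].

Lemma dsum_inj_id x : dsum_inj x i = x.
Proof. by rewrite ffunE dfwith_in. Qed.

Lemma dsum_inj_out x k : i != k -> dsum_inj x k = 0.
Proof. by move=> neq_ik; rewrite ffunE dfwith_out. Qed.

Fact dsum_inj_is_zmod_morphism : zmod_morphism dsum_inj.
Proof.
move=> x y; apply/ffunP=> k; rewrite [RHS]ffunE [X in _ = _ + X]ffunE.
have [<-|neq_ik] := eqVneq i k; first by rewrite !dsum_inj_id.
by rewrite !dsum_inj_out // subrr.
Qed.

HB.instance Definition _ :=
  GRing.isZmodMorphism.Build (A i) (ring_dsum A) dsum_inj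
    dsum_inj_is_zmod_morphism.

Lemma dsum_injM : {morph dsum_inj : x y / x * y}.
Proof.
move=> x y; apply/ffunP=> k; rewrite [RHS]ffunE.
have [<-|neq_ik] := eqVneq i k; first by rewrite !dsum_inj_id.
by rewrite !dsum_inj_out // mulr0.
Qed.

End DirectSumInjection.

Lemma dsum_sumE (I : finType) (A : I -> pzRingType) (J : Type) (r : seq J)
    (x : J -> ring_dsum A) (k : I) :
  (\sum_(i <- r) x i) k = \sum_(i <- r) x i k.
Proof.
elim: r => [|i r IHr]; first by rewrite !big_nil ffunE.
by rewrite !big_cons ffunE IHr.
Qed.

Lemma dsum_one_sum (I : finType) (A : I -> pzRingType) :
  1 = \sum_i dsum_inj (1 : A i) :> ring_dsum A.
Proof.
apply/ffunP=> k; rewrite dsum_sumE ffunE (bigD1 k) //= dsum_inj_id.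
by rewrite big1 ?addr0 // => i neq_ik; rewrite dsum_inj_out.
Qed.

Lemma no_commutative_image_matrix_dsum (j : nat) (F : 'I_j -> finFieldType)
    (n : 'I_j -> nat) (C : comNzRingType) :
  (forall t, 1 < n t)%N -> {rmorphism matrix_dsum F n -> C} -> False.
Proof.
move=> n_gt1 f; have /eqP[] := oner_neq0 C.
rewrite -(rmorph1 f) dsum_one_sum raddf_sum big1 // => t _.
pose A s : pzRingType := 'M[F s]_(n s).
pose ft : {additive A t -> C} := f \o @dsum_inj _ A t.
apply: (commutative_matrix_image0 (f := ft)) => // X Y.
by rewrite /= -rmorphM -dsum_injM.
Qed.

Lemma group_algebra_not_matrix_dsum (Fq : finFieldType) (gT : finGroupType)
    (j : nat) (F : 'I_j -> finFieldType) (n : 'I_j -> nat) :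
  (forall t, 1 < n t)%N ->
  ~ ring_isomorphic (group_algebra Fq gT) (matrix_dsum F n).
Proof.
move=> n_gt1 [f [g fK gK]].
have gZ : zmod_morphism g by apply: can2_zmod_morphism fK gK.
have gM : monoid_morphism g by apply: can2_monoid_morphism fK gK.
pose gA := GRing.isZmodMorphism.Build _ _ g gZ.
pose gR := GRing.isMonoidMorphism.Build _ _ g gM.
pose g' : {rmorphism matrix_dsum F n -> group_algebra Fq gT} :=
  HB.pack g gA gR.
exact: no_commutative_image_matrix_dsum n_gt1 (@augmentation Fq gT \o g').
Qed.

Lemma M2_F2_same_characteristic :
  same_characteristic (fun _ : 'I_1 => 'F_2 : finFieldType).
Proof. by exists 2%N => _; apply: pchar_Fp. Qed.

Definition M2_F2 : O2 :=
  @MkO2 1 (fun=> 'F_2 : finFieldType) (fun=> 2%N) isT (fun=> isT)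
    M2_F2_same_characteristic.

Local Close Scope ring_scope.

Theorem mainTheorem1 :
  (forall (j : nat) (F : 'I_j -> finFieldType) (n : 'I_j -> nat),
     0 < j -> same_characteristic F -> (forall t : 'I_j, 1 < n t) ->
     ~ (exists (Fq : finFieldType) (gT : finGroupType),
          semisimple_ring (group_algebra Fq gT) /\
          ring_isomorphic (group_algebra Fq gT) (matrix_dsum F n)))
  /\ (forall R : O2, (forall t : 'I_(O2_num R), 1 < O2_size t) ->
        ~ (exists A : O1, psi_eq A R))
  /\ inverse_problem_ill_posed.
Proof.
have no_preimage (R : O2) : (forall t : 'I_(O2_num R), 1 < O2_size t) ->
    ~ (exists A : O1, psi_eq A R).
  by move=> n_gt1 [A]; apply: group_algebra_not_matrix_dsum.
split; last split=> //; last by exists M2_F2; left; apply: no_preimage.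
move=> j F n _ _ n_gt1 [Fq [gT [_]]].
exact: group_algebra_not_matrix_dsum.
Qed.
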